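(* Let $\tau$ be a generic Euclidean triangle with triangle group $G_\tau=\langle r_1,r_2,r_3\rangle$ (see context). Then $G_\tau$ admits the presentation $$\langle x_1,x_2,x_3 \mid x_1^2,\ x_2^2,\ x_3^2,\ [\,v,\ h_{n,m}^{-1}\,v\,h_{n,m}\,]\ \text{ for } n,m\in\mathbb{Z},\ (n,m)>(0,0)\rangle,$$ where $v=[x_2x_1,x_1x_3]$ and $h_{n,m}=(x_2x_1)^n(x_1x_3)^m$, with the generator $x_i$ corresponding to $r_i$ for $i=1,2,3$.
   Context: A Euclidean triangle $\tau=A_1A_2A_3$ has edges $e_i=A_jA_k$ of length $\ell_i>0$, $\{i,j,k\}=\{1,2,3\}$. It is generic if for some real $k>0$ the numbers $k\ell_1,k\ell_2,k\ell_3$ are algebraically independent over $\mathbb{Q}$. Let $r_i$ be the reflection of the plane across the line containing $e_i$ and $G_\tau=\langle r_1,r_2,r_3\rangle\subset \mathrm{E}(2)$, with products composed left to right ($(x)gh=((x)g)h$). Commutators are $[a,b]=aba^{-1}b^{-1}$. The order on pairs is lexicographic: $(n,m)>(0,0)$ means $n>0$, or $n=0$ and $m>0$. *)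

(* Defs.v *)
From HB Require Import structures.
From mathcomp Require Import all_boot all_order all_algebra.
From mathcomp Require Import reals.
From mathcomp Require Import mpoly.

Set Implicit Arguments.
Unset Strict Implicit.
Unset Printing Implicit Defensive.

Import Order.TTheory GRing.Theory Num.Theory.
Local Open Scope ring_scope.

Section Plane.
Variable R : realType.

Definition point := (R * R)%type.

Definition padd (p q : point) : point := (p.1 + q.1, p.2 + q.2).
Definition psub (p q : point) : point := (p.1 - q.1, p.2 - q.2).
Definition pscale (a : R) (p : point) : point := (a * p.1, a * p.2).
Definition pdot (p q : point) : R := p.1 * q.1 + p.2 * q.2.

Definition dist (p q : point) : R := Num.sqrt (pdot (psub p q) (psub p q)).

Definition noncollinear (A1 A2 A3 : point) : Prop :=
  (A2.1 - A1.1) * (A3.2 - A1.2) - (A2.2 - A1.2) * (A3.1 - A1.1) != 0.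

Definition reflect_line (P Q : point) (x : point) : point :=
  let d := psub Q P in
  let u := psub x P in
  padd P (psub (pscale (2 * pdot u d / pdot d d) d) u).

(* Triangle tau = A_1 A_2 A_3 (indices 0,1,2 for 1,2,3); edge e_i = A_j A_k. *)
Definition vtx (A1 A2 A3 : point) (i : 'I_3) : point :=
  match val i with 0 => A1 | 1 => A2 | _ => A3 end.

Definition edge_pts (A1 A2 A3 : point) (i : 'I_3) : point * point :=
  match val i with 0 => (A2, A3) | 1 => (A1, A3) | _ => (A1, A2) end.

Definition edge_len (A1 A2 A3 : point) (i : 'I_3) : R :=
  dist (edge_pts A1 A2 A3 i).1 (edge_pts A1 A2 A3 i).2.

Definition refl (A1 A2 A3 : point) (i : 'I_3) : point -> point :=
  reflect_line (edge_pts A1 A2 A3 i).1 (edge_pts A1 A2 A3 i).2.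

Definition alg_indep3 (v : 'I_3 -> R) : Prop :=
  forall p : {mpoly rat[3]}, p != 0 -> (map_mpoly (ratr : rat -> R) p).@[v] != 0.

Definition generic_triangle (A1 A2 A3 : point) : Prop :=
  exists k : R, 0 < k /\ alg_indep3 (fun i => k * edge_len A1 A2 A3 i).

End Plane.

(* A letter (i, true) is x_{i+1}; (i, false) is x_{i+1}^{-1}. *)
Definition letter := ('I_3 * bool)%type.
Definition word := seq letter.

Definition inv_letter (a : letter) : letter := (a.1, ~~ a.2).
Definition inv_word (w : word) : word := rev (map inv_letter w).

Definition gen (i : 'I_3) : word := [:: (i, true)].
Definition x1 : word := gen (@Ordinal 3 0 isT).
Definition x2 : word := gen (@Ordinal 3 1 isT).
Definition x3 : word := gen (@Ordinal 3 2 isT).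

Definition pow_word (w : word) (n : int) : word :=
  match n with
  | Posz k => flatten (nseq k w)
  | Negz k => flatten (nseq k.+1 (inv_word w))
  end.

Definition comm_word (a b : word) : word := a ++ b ++ inv_word a ++ inv_word b.

Definition v_word : word := comm_word (x2 ++ x1) (x1 ++ x3).
Definition h_word (n m : int) : word := pow_word (x2 ++ x1) n ++ pow_word (x1 ++ x3) m.

Definition lex_pos (n m : int) : Prop := (0 < n)%R \/ (n = 0 /\ (0 < m)%R).

Definition relator (r : word) : Prop :=
  (exists i : 'I_3, r = gen i ++ gen i) \/
  (exists n m : int, lex_pos n m /\
     r = comm_word v_word (inv_word (h_word n m) ++ v_word ++ h_word n m)).

(* The equivalence on words defining the presented group: generated by
   deleting (anywhere in a word) a relator or a cancelling pair a a^{-1}. *)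
Inductive wequiv : word -> word -> Prop :=
| wequiv_refl w : wequiv w w
| wequiv_sym w1 w2 : wequiv w1 w2 -> wequiv w2 w1
| wequiv_trans w1 w2 w3 : wequiv w1 w2 -> wequiv w2 w3 -> wequiv w1 w3
| wequiv_rel u r v : relator r -> wequiv (u ++ r ++ v) (u ++ v)
| wequiv_cancel u a v : wequiv (u ++ [:: a; inv_letter a] ++ v) (u ++ v).

(* Evaluation of a word in G_tau, with right action: (x)gh = ((x)g)h.
   Each r_i is an involution, so x_i^{-1} is sent to r_i^{-1} = r_i. *)
Fixpoint eval_word (R : realType) (A1 A2 A3 : point R) (w : word)
  : point R -> point R :=
  match w with
  | [::] => id
  | a :: w' => fun x => eval_word A1 A2 A3 w' (refl A1 A2 A3 a.1 x)
  end.

Definition in_G (R : realType) (A1 A2 A3 : point R) (g : point R -> point R) : Prop :=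
  exists w : word, g = eval_word A1 A2 A3 w.

(* Main.v *)
Require Import Defs.
From HB Require Import structures.
From mathcomp Require Import all_boot all_order all_algebra.
From mathcomp Require Import reals.
From mathcomp Require Import mpoly.
From mathcomp Require Import zify ring complex generic_quotient boolp.

(* Put a = x2 x1, b = x1 x3, v = [a, b] and V n m = h^-1 v h with h = a^n b^m.
   Conjugation by b maps V n m to V n (m + 1), and conjugation by a maps V n m
   to V (n + 1) m up to conjugation by a product of elements V 1 j. Playing the
   two against each other, the relators [v, V n m] force all the V n m to
   commute in the presented group, so that every word of even length equals
   a^n b^m times a product of elements (V n_i m_i)^{+-1}.

   In the plane, identified with the complex numbers, a and b are rotations with
   factors z and w about two vertices, v is a nonzero translation by t, and V n m
   is the translation by t z^n w^m. Hence a word acting as the identity is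
   trivial as soon as the monomials z^n w^m are linearly independent over Z.
   By the law of cosines z and w are rational functions of the sides x0, x1, x2
   and of J = 4i * area, where J^2 is a polynomial in the sides. A relation
   between the monomials thus reads U + J V = 0 with U, V in Q[x0, x1, x2]; since
   J is imaginary and the sides are algebraically independent, U = V = 0, and
   the relation persists for all other values of the sides. For the sides
   st - 1/(st), t - 1/t, s - 1/s, the two factors become s^2 and t^2 with s, t
   arbitrary integers, so the relation is trivial. *)

Set Implicit Arguments.
Unset Strict Implicit.
Unset Printing Implicit Defensive.

Import Order.TTheory GRing.Theory Num.Theory.
Local Open Scope ring_scope.
Local Open Scope quotient_scope.

(** * Groups in which v commutes with its conjugates by a^n b^m *)

Lemma int_step_ind (P : int -> Prop) :
  P 0 -> (forall n, P n -> P (n + 1)) -> (forall n, P n -> P (n - 1)) ->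
  forall n, P n.
Proof.
move=> P0 PS PP; case=> n.
  elim: n => // n IHn.
  have -> : Posz n.+1 = Posz n + 1 by lia.
  exact: PS.
elim: n => [|n IHn]; first exact: (PP _ P0).
have -> : Negz n.+1 = Negz n - 1 by lia.
exact: PP.
Qed.

Section IntegerPowers.
Variable G : groupType.
Implicit Types (x y : G) (m n : int).
Local Open Scope group_scope.

(** Follows the two cases of [pow_word], so that [cls_pow] compares them case by case. *)
Definition expgz x n : G :=
  match n with Posz k => x ^+ k | Negz k => x^-1 ^+ k.+1 end.

Lemma expgz0 x : expgz x 0%R = 1. Proof. by []. Qed.

Lemma expgz1 x : expgz x 1%R = x. Proof. by []. Qed.

Lemma expgzS x n : expgz x (n + 1)%R = expgz x n * x.
Proof.
case: n => [k|[|k]].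
- have -> : (Posz k + 1)%R = Posz k.+1 by lia.
  by rewrite /= expgSr.
- by rewrite /= mulVg.
- have -> : (Negz k.+1 + 1)%R = Negz k by lia.
  by rewrite /expgz (expgSr _ k.+1) mulgVK.
Qed.

Lemma expgzP x n : expgz x (n - 1)%R = expgz x n * x^-1.
Proof. by rewrite -[in RHS](subrK 1%R n) expgzS mulgK. Qed.

Lemma expgzD x m n : expgz x (m + n)%R = expgz x m * expgz x n.
Proof.
elim/int_step_ind: n => [|n IHn|n IHn]; first by rewrite addr0 mulg1.
  by rewrite addrA !expgzS IHn mulgA.
by rewrite addrA !expgzP IHn mulgA.
Qed.

Lemma expgzSl x n : expgz x (n + 1)%R = x * expgz x n.
Proof. by rewrite addrC expgzD expgz1. Qed.

End IntegerPowers.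

Section Metabelian.
Variables (G : groupType) (a b : G).
Local Open Scope group_scope.

Let v := a * b * a^-1 * b^-1.
Let h (n m : int) := expgz a n * expgz b m.
Definition commconj (n m : int) : G := v ^ h n m.
Local Notation V := commconj.

Lemma commuteJ (x y z : G) : commute x y -> commute (x ^ z) (y ^ z).
Proof. by move=> cxy; rewrite /commute -!conjMg cxy. Qed.

Lemma commute_conj (x y : G) : commute x y -> x ^ y = x.
Proof. by move=> cxy; rewrite conjgE cxy mulKg. Qed.

Lemma commconjJb n m : V n m ^ b = V n (m + 1)%R.
Proof. by rewrite /V -conjgM /h -mulgA -expgzS. Qed.

Lemma commconjJbz n m k : V n m ^ expgz b k = V n (m + k)%R.
Proof. by rewrite /V -conjgM /h -mulgA -expgzD. Qed.

(** The error made in moving [a] past [b^m]: [b^m a = a b^m (c m)^-1]. The recursions [cS] and [cP]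
    write it as a product of elements [V 1 j] and their inverses, so whatever commutes with all
    [V 1 j] commutes with it. *)
Let c (m : int) := a^-1 * (expgz b m)^-1 * a * expgz b m.

Lemma commconjJa n m : V n m ^ a = V (n + 1)%R m ^ (c m)^-1.
Proof.
rewrite /V -!conjgM; congr (_ ^ _).
by rewrite /h /c expgzS !gnorm.
Qed.

Let cS m : c (m + 1)%R = c m * V 1%R (m + 1)%R.
Proof. by rewrite /V /c /h expgzSl expgz1 conjgE /v !gnorm. Qed.

Let cP m : c (m - 1)%R = c m * (V 1%R m)^-1.
Proof. by have := cS (m - 1)%R; rewrite subrK => ->; rewrite mulgK. Qed.

Let c0 : c 0%R = 1.
Proof. by rewrite /c expgz0 !gnorm. Qed.

Let c_commute (x : G) :
  (forall k, commute x (V 1%R k)) -> forall m, commute x (c m).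
Proof.
move=> xV; elim/int_step_ind => [|n IHn|n IHn].
- by rewrite c0; apply: commute1.
- by rewrite cS; apply: commuteM.
- by rewrite cP; apply: commuteM => //; apply: commuteV.
Qed.

(** * Commutation of all the [V n m] *)

Hypothesis vV : forall n m, lex_pos n m -> commute v (V n m).

Let v00 : v = V 0%R 0%R.
Proof. by rewrite /V /h !expgz0 mulg1 conjg1. Qed.

(** Conjugating by a power of [b] turns [V 0 k] into [v] and leaves a relator. If [n = 0] and
    [m < k], it is [V n m] that is moved to [v] instead. *)
Let V0V n k m : (0 <= n)%R -> commute (V 0%R k) (V n m).
Proof.
move=> n0.
have key j : n != 0%R \/ (0 < j)%R -> commute (V 0%R 0%R) (V n j).
  by move=> nj; rewrite -v00; apply: vV; rewrite /lex_pos; lia.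
have shift i j l :
    commute (V 0%R i) (V n j) -> commute (V 0%R (i + l)%R) (V n (j + l)%R).
  by move=> C; rewrite -!(commconjJbz _ _ l); apply: commuteJ.
have [n1|n1] := eqVneq n 0%R; last first.
  have := shift _ _ k (key (m - k)%R (or_introl n1)).
  by rewrite add0r subrK.
case: (ltrgtP k m) => km.
- have m_k : (0 < m - k)%R by rewrite subr_gt0.
  have := shift _ _ k (key (m - k)%R (or_intror m_k)).
  by rewrite add0r subrK.
- have k_m : (0 < k - m)%R by rewrite subr_gt0.
  have := shift _ _ m (key (k - m)%R (or_intror k_m)).
  by rewrite add0r subrK n1; apply: commute_sym.
- by rewrite km n1; apply: commute_refl.
Qed.

(* Induction on k: conjugating [V 0 0, V 0 k] = 1 by a turns V 0 k into
   V 1 k conjugated by a product of V 1 1, ..., V 1 k, which is V 1 k itself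
   by the induction hypothesis. *)
Let V1V1_nat (k : nat) (j : int) : commute (V 1%R j) (V 1%R (j + k%:Z)%R).
Proof.
elim/ltn_ind: k j => k IHk j.
case: k IHk => [|k] IHk; first by rewrite addr0; apply: commute_refl.
have ck (l : nat) : (l <= k.+1)%N -> commute (V 1%R k.+1%:Z) (c l%:Z).
  elim: l => [|l IHl] lk; first by rewrite c0; apply: commute1.
  have -> : l.+1%:Z = (l%:Z + 1)%R by lia.
  rewrite cS; apply: commuteM; first by apply: IHl; lia.
  apply: commute_sym.
  have -> : k.+1%:Z = ((l%:Z + 1) + (k - l)%N%:Z)%R by lia.
  by apply: IHk; lia.
have : commute (V 1%R 0%R) (V 1%R k.+1%:Z).
  have := commuteJ a (V0V 0%R k.+1%:Z (lexx 0%R)).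
  rewrite !commconjJa add0r c0 invg1 conjg1.
  by rewrite [X in commute _ X]commute_conj //; apply/commuteV/ck.
move/(commuteJ (expgz b j)); rewrite !commconjJbz add0r.
by rewrite addrC.
Qed.

Let V1V1 j k : commute (V 1%R j) (V 1%R k).
Proof.
have [jk|/ltW kj] := lerP j k.
  have -> : k = (j + `|k - j|%N%:Z)%R by lia.
  exact: V1V1_nat.
apply: commute_sym.
have -> : j = (k + `|j - k|%N%:Z)%R by lia.
exact: V1V1_nat.
Qed.

(** Conjugating [[V 0 k, V (n - 1) m] = 1] by [a] makes [V 1 k] commute with [V n m] conjugated by
    [(c m)^-1]. Since [V 1 k] commutes with every [c j], the correction can be removed. *)
Let V1V n k m : (0 <= n)%R -> commute (V 1%R k) (V n m).
Proof.
move=> n0; have [->|n1] := eqVneq n 0%R; first exact/commute_sym/V0V.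
have cV1 j : commute (V 1%R k) (c j) by apply: c_commute => i; apply: V1V1.
have n'0 : (0 <= n - 1)%R by lia.
have := commuteJ a (V0V k m n'0).
rewrite !commconjJa add0r subrK [X in commute X]commute_conj; last exact: commuteV.
by move/(commuteJ (c m)); rewrite conjgKV commute_conj.
Qed.

Let VJa_le n m : (0 <= n)%R -> V n m ^ a = V (n + 1)%R m.
Proof.
move=> n0; rewrite commconjJa commute_conj //; apply/commuteV/c_commute => k.
by apply/commute_sym/V1V; lia.
Qed.

Let V_commute_nat (i j : nat) k m : commute (V i%:Z k) (V (i + j)%:Z m).
Proof.
elim: i => [|i IHi]; first exact: V0V.
have := commuteJ a IHi; rewrite !VJa_le //.
by rewrite -!PoszD !addn1 addSn.
Qed.

(** Descent to negative first indices. For [n >= -p] the induction hypothesis makes [V n l] commute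
    with all [V 1 q], hence with [c l], so conjugation by [a^-1] lowers the first index with no
    correction. *)
Let V_commute_ge (p : nat) i j k m :
  (- p%:Z <= i -> - p%:Z <= j -> commute (V i k) (V j m))%R.
Proof.
elim: p i j k m => [|p IHp] i j k m.
  rewrite oppr0; case: i => // i _; case: j => // j _.
  have [ij|/ltnW ji] := leqP i j.
    by rewrite -(subnKC ij); apply: V_commute_nat.
  by apply/commute_sym; rewrite -(subnKC ji); apply: V_commute_nat.
have VJ n l : (- p%:Z <= n)%R -> V (n - 1)%R l = V n l ^ a^-1.
  move=> pn; rewrite -[LHS](conjgK a) commconjJa subrK; congr (_ ^ _).
  apply/commute_conj/commuteV/c_commute => q.
  by apply: IHp => //; lia.
move=> pi pj; rewrite -(addrK 1%R i) -(addrK 1%R j).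
by rewrite !VJ; [apply/commuteJ/IHp|..]; lia.
Qed.

Theorem commconj_commute i j k m : commute (V i k) (V j m).
Proof. by apply: (@V_commute_ge (`|i| + `|j|)%N); lia. Qed.

Lemma commconjJa1 n m : V n m ^ a = V (n + 1)%R m.
Proof.
by rewrite commconjJa commute_conj //; apply/commuteV/c_commute => k;
  apply: commconj_commute.
Qed.

(** * Products of the [V n m] and the normal form *)

Definition signed (s : bool) (x : G) : G := if s then x else x^-1.

(** One list of signed indices encodes at once this product, the word [commconj_word] and the scalar
    [laurent_sum]. *)
Definition commconj_prod (L : seq (int * int * bool)) : G :=
  \prod_(t <- L) signed t.2 (V t.1.1 t.1.2).

Let shift (i j : int) (L : seq (int * int * bool)) :=
  [seq ((t.1.1 + i)%R, (t.1.2 + j)%R, t.2) | t <- L].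

Let prod_shift x i j L : (forall n m, V n m ^ x = V (n + i)%R (m + j)%R) ->
  commconj_prod L ^ x = commconj_prod (shift i j L).
Proof.
move=> Vx; rewrite /commconj_prod big_map conjg_prod; apply: eq_bigr => -[[n m] []] _ /=.
  exact: Vx.
by rewrite conjVg Vx.
Qed.

(** The subgroup generated by the [V n m]. It is stable under conjugation by [a], [b] and their
    inverses and contains every [c m], so it absorbs all errors made in collecting powers of [a] and
    [b] on the left. *)
Let inN (x : G) := exists L, x = commconj_prod L.

Let inNM x y : inN x -> inN y -> inN (x * y).
Proof. by move=> [L ->] [M ->]; exists (L ++ M); rewrite /commconj_prod big_cat. Qed.

Let inNV x : inN x -> inN x^-1.
Proof.
move=> [L ->]; elim: L => [|[[n m] s] L [M IH]].
  by exists [::]; rewrite /commconj_prod !big_nil invg1.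
exists (M ++ [:: (n, m, ~~ s)]).
rewrite {1}/commconj_prod big_cons invgM IH /commconj_prod big_cat big_seq1.
by case: s; rewrite /= ?invgK.
Qed.

Let VJa n m : V n m ^ a = V (n + 1)%R (m + 0)%R.
Proof. by rewrite addr0 commconjJa1. Qed.
Let VJaV n m : V n m ^ a^-1 = V (n - 1)%R (m + 0)%R.
Proof. by rewrite addr0 -[in LHS](subrK 1%R n) -commconjJa1 conjgK. Qed.
Let VJb n m : V n m ^ b = V (n + 0)%R (m + 1)%R.
Proof. by rewrite addr0 commconjJb. Qed.
Let VJbV n m : V n m ^ b^-1 = V (n + 0)%R (m - 1)%R.
Proof. by rewrite addr0 -[in LHS](subrK 1%R m) -commconjJb conjgK. Qed.

Let inNJa x : inN x -> inN (x ^ a).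
Proof. by move=> [L ->]; eexists; apply: prod_shift VJa. Qed.
Let inNJaV x : inN x -> inN (x ^ a^-1).
Proof. by move=> [L ->]; eexists; apply: prod_shift VJaV. Qed.
Let inNJb x : inN x -> inN (x ^ b).
Proof. by move=> [L ->]; eexists; apply: prod_shift VJb. Qed.
Let inNJbV x : inN x -> inN (x ^ b^-1).
Proof. by move=> [L ->]; eexists; apply: prod_shift VJbV. Qed.

Let inNc m : inN (c m).
Proof.
have inNVc k : inN (V 1%R k) by exists [:: (1%R, k, true)]; rewrite /commconj_prod big_seq1.
elim/int_step_ind: m => [|n IHn|n IHn].
- by exists [::]; rewrite c0 /commconj_prod big_nil.
- by rewrite cS; apply: inNM.
- by rewrite cP; apply: inNM => //; apply: inNV.
Qed.

Definition normal_form (g : G) :=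
  exists n m L, g = expgz a n * expgz b m * commconj_prod L.

Lemma normal_form1 : normal_form 1.
Proof. by exists 0%R, 0%R, [::]; rewrite /commconj_prod big_nil !mulg1. Qed.

Lemma normal_formMa g : normal_form g -> normal_form (g * a).
Proof.
move=> [n [m [L ->]]].
have [M E] : inN ((c m)^-1 * commconj_prod L ^ a).
  by apply: inNM; [apply/inNV/inNc|apply: inNJa; exists L].
by exists (n + 1)%R, m, M; rewrite -E /c expgzS conjgE !gnorm.
Qed.

Lemma normal_formMaV g : normal_form g -> normal_form (g * a^-1).
Proof.
move=> [n [m [L ->]]].
have [M E] : inN (c m ^ a^-1 * commconj_prod L ^ a^-1).
  by apply: inNM; [apply/inNJaV/inNc|apply: inNJaV; exists L].
by exists (n - 1)%R, m, M; rewrite -E /c expgzP !conjgE !gnorm.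
Qed.

Lemma normal_formMb g : normal_form g -> normal_form (g * b).
Proof.
move=> [n [m [L ->]]].
have [M E] : inN (commconj_prod L ^ b) by apply: inNJb; exists L.
by exists n, (m + 1)%R, M; rewrite -E expgzS conjgE !gnorm.
Qed.

Lemma normal_formMbV g : normal_form g -> normal_form (g * b^-1).
Proof.
move=> [n [m [L ->]]].
have [M E] : inN (commconj_prod L ^ b^-1) by apply: inNJbV; exists L.
by exists n, (m - 1)%R, M; rewrite -E expgzP conjgE !gnorm.
Qed.

(** The net exponent of [V nm] in the product, and also the coefficient of the monomial [z^n w^m] in
    [laurent_sum]. *)
Definition coef (L : seq (int * int * bool)) (nm : int * int) : int :=
  \sum_(t <- L | t.1 == nm) (if t.2 then 1 else -1)%R.

(** By commutativity the head of the list cancels against a later entry with the same index and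
    opposite sign; the rest follows by induction on the length. *)
Lemma commconj_prod_eq1 L : (forall nm, coef L nm = 0%R) -> commconj_prod L = 1.
Proof.
have [k] := ubnP (size L); elim: k L => // k IHk [|[nm s] L] sz cL.
  by rewrite /commconj_prod big_nil.
pose e (s : bool) : int := (if s then 1 else -1)%R.
(* Otherwise all entries with index [nm] carry the sign [s], and their sum cannot vanish. *)
have inL : (nm, ~~ s) \in L.
  apply/negPn/negP => nin.
  have : (0 <= \sum_(t <- L | t.1 == nm) e s * e t.2)%R.
    rewrite big_seq_cond; apply: sumr_ge0 => -[x s'] /andP[xL /eqP xnm].
    have [<-|ss'] := eqVneq s s'; first by case: (s).
    by move: nin xL; rewrite -xnm (_ : ~~ s = s') => [/negP//|]; case: (s) (s') ss' => [] [].
  rewrite -mulr_sumr; have := cL nm; rewrite /coef big_cons /= eqxx /e.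
  by move: (\sum_(t <- L | _) _)%R => S; case: (s); lia.
case/splitPr: inL sz cL => L1 L2 sz cL.
have -> : commconj_prod ((nm, s) :: L1 ++ (nm, ~~ s) :: L2) = commconj_prod (L1 ++ L2).
  rewrite /commconj_prod !(big_cons, big_cat) /= mulgA.
  set x := signed s _.
  have -> : signed (~~ s) (V nm.1 nm.2) = x^-1 by rewrite /x; case: (s); rewrite /= ?invgK.
  have xC : commute x (\prod_(t <- L1) signed t.2 (V t.1.1 t.1.2)).
    apply: commute_prod => -[[n m] s'] _ /=; rewrite /x.
    have C : commute (V nm.1 nm.2) (V n m) by apply: commconj_commute.
    case: (s) (s') => [] [] //=; last apply: commuteV; try exact: commuteV;
      apply: commute_sym; try exact: commuteV; exact: commute_sym.
  by rewrite xC -!mulgA mulVKg.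
apply: IHk => [|x]; first by move: sz; rewrite /= !size_cat /=; lia.
have := cL x; rewrite /coef big_cons !big_cat big_cons /=.
move: (\sum_(t <- L1 | _) _)%R (\sum_(t <- L2 | _) _)%R => S1 S2.
by case: eqP => // _; case: (s) => /=; lia.
Qed.

End Metabelian.

(** * The presented group *)

Lemma inv_letterK : involutive inv_letter.
Proof. by case=> i s; rewrite /inv_letter /= negbK. Qed.

Lemma inv_word_cat u v : inv_word (u ++ v) = inv_word v ++ inv_word u.
Proof. by rewrite /inv_word map_cat rev_cat. Qed.

Lemma inv_wordK : involutive inv_word.
Proof.
by move=> w; rewrite /inv_word map_rev revK mapK //; apply: inv_letterK.
Qed.

(** * Words modulo the relators form a group *)

Lemma wequiv_cat u u' v v' : wequiv u u' -> wequiv v v' -> wequiv (u ++ v) (u' ++ v').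
Proof.
move=> uu' vv'; apply: (@wequiv_trans _ (u' ++ v)).
  elim: uu' => {u u'} [w|w1 w2 _ IH|w1 w2 w3 _ IH1 _ IH2|u r w rr|u a w].
  - exact: wequiv_refl.
  - exact: wequiv_sym.
  - exact: wequiv_trans IH1 IH2.
  - by rewrite -!catA; apply: wequiv_rel.
  - by rewrite -!catA; apply: wequiv_cancel.
elim: vv' => {v v'} [w|w1 w2 _ IH|w1 w2 w3 _ IH1 _ IH2|u1 r w rr|u1 a w].
- exact: wequiv_refl.
- exact: wequiv_sym.
- exact: wequiv_trans IH1 IH2.
- by rewrite !(catA u' u1); apply: wequiv_rel.
- by rewrite !(catA u' u1); apply: wequiv_cancel.
Qed.

Lemma wequiv_catV w : wequiv (w ++ inv_word w) [::].
Proof.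
elim: w => [|x w IH]; first exact: wequiv_refl.
rewrite -cat1s inv_word_cat -catA (catA w).
apply: (@wequiv_trans _ ([:: x] ++ inv_word [:: x])); last exact: (wequiv_cancel [::] x [::]).
apply: wequiv_cat; first exact: wequiv_refl.
by rewrite -[X in wequiv _ X]cat0s; apply: wequiv_cat IH _; apply: wequiv_refl.
Qed.

Lemma wequiv_Vcat w : wequiv (inv_word w ++ w) [::].
Proof. by rewrite -{2}(inv_wordK w); apply: wequiv_catV. Qed.

Lemma wequiv_inv u v : wequiv u v -> wequiv (inv_word u) (inv_word v).
Proof.
move=> uv; apply: (@wequiv_trans _ (inv_word u ++ (v ++ inv_word v))).
  rewrite -{1}(cats0 (inv_word u)); apply: wequiv_cat; first exact: wequiv_refl.
  exact/wequiv_sym/wequiv_catV.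
rewrite catA -[X in wequiv _ X]cat0s; apply: wequiv_cat; last exact: wequiv_refl.
apply: wequiv_trans (wequiv_Vcat u); apply: wequiv_cat; first exact: wequiv_refl.
exact: wequiv_sym.
Qed.

Definition weqb : rel word := fun u v => `[< wequiv u v >].

Lemma weqb_refl : reflexive weqb.
Proof. by move=> u; apply/asboolP; apply: wequiv_refl. Qed.

Lemma weqb_sym : ssrbool.symmetric weqb.
Proof. by move=> u v; apply/asboolP/asboolP; apply: wequiv_sym. Qed.

Lemma weqb_trans : transitive weqb.
Proof.
by move=> v u w /asboolP uv /asboolP vw; apply/asboolP; apply: wequiv_trans uv vw.
Qed.

Canonical weqb_equiv := EquivRel weqb weqb_refl weqb_sym weqb_trans.

Definition presented := {eq_quot weqb_equiv}.
HB.instance Definition _ := Choice.on presented.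

Definition cls (w : word) : presented := \pi_{eq_quot weqb_equiv} w.

Lemma clsP u v : cls u = cls v <-> wequiv u v.
Proof. by split=> [/eqmodP/asboolP|uv] //; apply/eqmodP/asboolP. Qed.

Lemma cls_surj (x : presented) : exists w, x = cls w.
Proof. by exists (repr x); rewrite /cls reprK. Qed.

Definition rep (x : presented) : word := repr x.

Lemma rep_cls w : wequiv (rep (cls w)) w.
Proof. by apply/clsP; rewrite /cls /rep reprK. Qed.

Definition pmul (x y : presented) : presented := cls (rep x ++ rep y).
Definition pinv (x : presented) : presented := cls (inv_word (rep x)).

Lemma pmul_cls u v : pmul (cls u) (cls v) = cls (u ++ v).
Proof. by apply/clsP/wequiv_cat; apply: rep_cls. Qed.

Lemma pinv_cls u : pinv (cls u) = cls (inv_word u).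
Proof. by apply/clsP/wequiv_inv; apply: rep_cls. Qed.

Lemma pmulA : associative pmul.
Proof.
move=> x y z; have [[[u ->] [v ->]] [w ->]] := (cls_surj x, cls_surj y, cls_surj z).
by rewrite !pmul_cls catA.
Qed.

Lemma pmul1 : left_id (cls [::]) pmul.
Proof. by move=> x; have [u ->] := cls_surj x; rewrite pmul_cls. Qed.

Lemma pmulr1 : right_id (cls [::]) pmul.
Proof. by move=> x; have [u ->] := cls_surj x; rewrite pmul_cls cats0. Qed.

Lemma pmulV : left_inverse (cls [::]) pinv pmul.
Proof.
move=> x; have [u ->] := cls_surj x; rewrite pinv_cls pmul_cls.
exact/clsP/wequiv_Vcat.
Qed.

Lemma pmulrV : right_inverse (cls [::]) pinv pmul.
Proof.
move=> x; have [u ->] := cls_surj x; rewrite pinv_cls pmul_cls.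
exact/clsP/wequiv_catV.
Qed.

HB.instance Definition _ :=
  isGroup.Build presented pmulA pmul1 pmulr1 pmulV pmulrV.

(** * Normal form of words of even length *)

Section PresentedGroup.
Local Open Scope group_scope.

Lemma cls_nil : cls [::] = 1. Proof. by []. Qed.

Lemma cls_cat u v : cls (u ++ v) = cls u * cls v.
Proof. exact/esym/pmul_cls. Qed.

Lemma cls_inv u : cls (inv_word u) = (cls u)^-1.
Proof. exact/esym/pinv_cls. Qed.

Lemma cls_pow w n : cls (pow_word w n) = expgz (cls w) n.
Proof.
have flat u k : cls (flatten (nseq k u)) = cls u ^+ k.
  by elim: k => // k IHk; rewrite /= cls_cat IHk expgS.
by case: n => k; rewrite /pow_word flat ?cls_inv.
Qed.

Definition rot_a := cls (x2 ++ x1).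
Definition rot_b := cls (x1 ++ x3).

Lemma cls_v : cls v_word = rot_a * rot_b * rot_a^-1 * rot_b^-1.
Proof. by rewrite /v_word /comm_word /rot_a /rot_b !(cls_cat, cls_inv) !mulgA. Qed.

Lemma cls_commconj n m :
  cls (inv_word (h_word n m) ++ v_word ++ h_word n m) = commconj rot_a rot_b n m.
Proof. by rewrite cls_cat (cls_cat v_word) cls_inv cls_v (cls_cat (pow_word _ _)) !cls_pow. Qed.

Lemma cls_relator r : relator r -> cls r = 1.
Proof.
by move=> rr; apply/clsP; rewrite -[r]cats0; apply: (wequiv_rel [::] [::] rr).
Qed.

Lemma commconj_relator n m : lex_pos n m ->
  commute (rot_a * rot_b * rot_a^-1 * rot_b^-1) (commconj rot_a rot_b n m).
Proof.
move=> nm; rewrite -cls_v -cls_commconj.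
have /cls_relator : relator (comm_word v_word (inv_word (h_word n m) ++ v_word ++ h_word n m)).
  by right; exists n, m.
rewrite /comm_word cls_cat [cls (_ ++ inv_word _ ++ _)]cls_cat.
rewrite [cls (inv_word _ ++ inv_word _)]cls_cat !cls_inv !mulgA.
set x := cls v_word; set y := cls (_ ++ _) => /eqP.
by rewrite -mulgA -invgM divg_eq1 => /eqP.
Qed.

Definition commconj_word (L : seq (int * int * bool)) : word :=
  flatten [seq (let w := inv_word (h_word t.1.1 t.1.2) ++ v_word ++ h_word t.1.1 t.1.2
                in if t.2 then w else inv_word w) | t <- L].

Lemma cls_commconj_word L : cls (commconj_word L) = commconj_prod rot_a rot_b L.
Proof.
elim: L => [|[[n m] s] L IH]; first by rewrite /commconj_prod big_nil.
rewrite /commconj_word [flatten _]/= cls_cat IH /commconj_prod big_cons.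
by congr (_ * _); case: s; rewrite ?[cls (inv_word (_ ++ _))]cls_inv cls_commconj.
Qed.

Lemma cls_gen_sq i : cls (gen i) * cls (gen i) = 1.
Proof. by rewrite -cls_cat; apply: cls_relator; left; exists i. Qed.

Lemma cls_letter (l : letter) : cls [:: l] = cls (gen l.1).
Proof.
case: l => i [] //=; have -> : [:: (i, false)] = inv_word (gen i) by [].
by rewrite cls_inv; apply: mulg1_eq; apply: cls_gen_sq.
Qed.

(** The generators are involutions, so a product of two of them is [1], [a], [b], [a b] or the
    inverse of one of these. *)
Lemma normal_form_gen2 g (i j : 'I_3) :
  normal_form rot_a rot_b g -> normal_form rot_a rot_b (g * (cls (gen i) * cls (gen j))).
Proof.
have genV k : (cls (gen k))^-1 = cls (gen k) by apply/mulg1_eq/cls_gen_sq.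
have rel := commconj_relator.
have aE : rot_a = cls x2 * cls x1 by rewrite /rot_a cls_cat.
have bE : rot_b = cls x1 * cls x3 by rewrite /rot_b cls_cat.
have aVE : rot_a^-1 = cls x1 * cls x2 by rewrite aE invgM !genV.
have bVE : rot_b^-1 = cls x3 * cls x1 by rewrite bE invgM !genV.
have abE : cls x2 * cls x3 = rot_a * rot_b.
  by rewrite aE bE mulgA -(mulgA (cls x2)) cls_gen_sq mulg1.
have baE : cls x3 * cls x2 = rot_b^-1 * rot_a^-1.
  by rewrite aVE bVE mulgA -(mulgA (cls x3)) cls_gen_sq mulg1.
have ordE (k : 'I_3) : [\/ gen k = x1, gen k = x2 | gen k = x3].
  case: k => [[|[|[|//]]]] p; [constructor 1|constructor 2|constructor 3];
  by congr [:: (_, _)]; apply: val_inj.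
move=> NFg; case: (ordE i) => ->; case: (ordE j) => ->; rewrite ?cls_gen_sq ?mulg1 //.
- by rewrite -aVE; apply: normal_formMaV.
- by rewrite -bE; apply: normal_formMb.
- by rewrite -aE; apply: normal_formMa.
- by rewrite abE mulgA; apply: normal_formMb => //; apply: normal_formMa.
- by rewrite -bVE; apply: normal_formMbV.
- by rewrite baE mulgA; apply: normal_formMaV => //; apply: normal_formMbV.
Qed.

Lemma even_normal_form (w : word) : ~~ odd (size w) ->
  exists n m L, wequiv w (h_word n m ++ commconj_word L).
Proof.
move=> ew.
have : normal_form rot_a rot_b (cls w).
  rewrite -[cls w]mul1g; move: ew (normal_form1 rot_a rot_b); move: (1 : presented) => g.
  have [k] := ubnP (size w); elim: k w g => // k IHk [|x [|y w]] g //=.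
    by rewrite mulg1.
  rewrite negbK ltnS => sz ew NFg.
  have -> : x :: y :: w = [:: x] ++ [:: y] ++ w by [].
  rewrite (cls_cat [:: x]) (cls_cat [:: y]) (cls_letter x) (cls_letter y) mulgA mulgA -(mulgA g).
  by apply: IHk; [lia|done|apply: normal_form_gen2].
move=> [n [m [L E]]]; exists n, m, L; apply/clsP.
by rewrite E cls_cat cls_commconj_word /h_word cls_cat !cls_pow.
Qed.

Lemma commconj_word_nil L : (forall nm, coef L nm = 0%R) -> wequiv (commconj_word L) [::].
Proof.
move=> cL; apply/clsP; rewrite cls_commconj_word cls_nil.
by apply: commconj_prod_eq1 => //; apply: commconj_relator.
Qed.

End PresentedGroup.

(** * Linear independence of the rotation factors *)

Section LaurentSums.
Variable K : numFieldType.

Definition sgnr (s : bool) : K := if s then 1 else -1.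

Definition laurent_sum (L : seq (int * int * bool)) (z w : K) : K :=
  \sum_(t <- L) sgnr t.2 * z ^ t.1.1 * w ^ t.1.2.

Definition bounded_by (N : nat) (L : seq (int * int * bool)) :=
  forall t, t \in L -> (`|t.1.1| <= N)%N /\ (`|t.1.2| <= N)%N.

Lemma bounded_by_ex L : exists N, bounded_by N L.
Proof.
elim: L => [|[[n m] s] L [N bN]]; first by exists 0%N.
exists (N + `|n| + `|m|)%N => t; rewrite inE => /orP[/eqP-> /=|/bN]; lia.
Qed.

(** Multiplication by [(z w)^N] clears the negative exponents when [N] bounds them. *)
Definition nat_sum (N : nat) (L : seq (int * int * bool)) (z w : K) : K :=
  \sum_(t <- L) sgnr t.2 * z ^+ `|t.1.1 + N%:Z| * w ^+ `|t.1.2 + N%:Z|.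

Lemma nat_sumE N L z w : bounded_by N L -> z != 0 -> w != 0 ->
  nat_sum N L z w = laurent_sum L z w * (z ^+ N * w ^+ N).
Proof.
move=> bN z0 w0; rewrite /nat_sum /laurent_sum mulr_suml.
apply: eq_big_seq => -[[n m] s] /bN /= [nN mN].
have E (x : K) (k : int) : x != 0 -> (`|k| <= N)%N -> x ^+ `|k + N%:Z| = x ^ k * x ^+ N.
  move=> x0 kN; rewrite !exprnP -expfzDr //; congr (_ ^ _); lia.
by rewrite !E //; ring.
Qed.

Lemma sgnr_coef L nm : \sum_(t <- L | t.1 == nm) sgnr t.2 = (coef L nm)%:~R :> K.
Proof. by rewrite /coef rmorph_sum; apply: eq_bigr => -[_ []] _ //=; rewrite rmorphN1. Qed.

Lemma poly_nat_roots (p : {poly K}) :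
  (forall s : nat, (1 < s)%N -> p.[(s%:R ^+ 2)] = 0) -> p = 0.
Proof.
move=> rp; apply/eqP/negPn/negP => p0.
have := @max_poly_roots _ p [seq (k.+2%:R ^+ 2 : K) | k <- iota 0 (size p)] p0.
rewrite size_map size_iota ltnn; move=> H; suff : false by []; apply: H.
  by apply/allP => x /mapP[k _ ->]; apply/rootP/rp.
rewrite map_inj_in_uniq ?iota_uniq // => i j _ _ /eqP.
by rewrite -!natrX eqr_nat eqn_exp2r // => /eqP[].
Qed.

(* With second variable t = s ^ (2 N + 1), distinct monomials of degree at most
   2 N in each variable become distinct powers of s. *)
Lemma nat_sum_coef N L : bounded_by N L ->
  (forall s t : nat, (1 < s)%N -> (1 < t)%N -> nat_sum N L (s%:R ^+ 2) (t%:R ^+ 2) = 0) ->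
  forall nm, coef L nm = 0.
Proof.
move=> bN vanish [n m].
pose M := (2 * N).+1.
pose code (x : int * int) := (`|(x.1 + N%:Z)%R| + M * `|(x.2 + N%:Z)%R|)%N.
pose p : {poly K} := \sum_(t <- L) sgnr t.2 *: 'X^(code t.1).
have p0 : p = 0.
  apply: poly_nat_roots => s s1; rewrite /p horner_sum.
  have s1M : (1 < s ^ M)%N by rewrite -{1}(exp1n M) ltn_exp2r.
  rewrite -[RHS](vanish _ _ s1 s1M); apply: eq_bigr => t _.
  rewrite hornerZ hornerXn -mulrA /code exprD; congr (_ * (_ * _)).
  by rewrite natrX -!exprM !mulnA (mulnC 2).
have [nmL|nmL] := boolP ((n, m) \in [seq t.1 | t <- L]); last first.
  rewrite /coef /=; rewrite big_seq_cond big1 // => t /andP[tL /eqP E].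
  by case/negP: nmL; rewrite -E map_f.
have [t0 t0L t0E] := mapP nmL.
have [] := bN _ t0L; rewrite -t0E /= => nN mN.
apply/eqP; rewrite -(intr_eq0 K) -sgnr_coef.
have := congr1 (fun q : {poly K} => q`_(code (n, m))) p0.
rewrite /p coef0 coef_sum => E0; apply/eqP; rewrite -[RHS]E0.
rewrite [LHS]big_mkcond; apply: eq_big_seq => -[[n' m'] s] /bN /= [n'N m'N].
rewrite coefZ coefXn; case: eqP => [[-> ->]|ne]; first by rewrite eqxx mulr1.
case: eqP => [E|]; last by rewrite mulr0.
case: ne; move: E; rewrite /code /= /M => E.
(* The shifted exponents lie between [0] and [2 N], so they are the digits of [code] in base [M]. *)
have X (k : int) : (`|k| <= N)%N -> exists2 a : nat, (a <= 2 * N)%N & k = a%:Z - N%:Z.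
  by move=> kN; exists `|(k + N%:Z)%R|%N; lia.
move: E; have [[a aN ->] [b bN' ->]] := (X _ nN, X _ mN).
have [[a' a'N ->] [b' b'N ->]] := (X _ n'N, X _ m'N).
rewrite !subrK !absz_nat => E.
have bb : b = b'.
  have := congr1 (fun k => k %/ (2 * N).+1)%N E.
  by rewrite !(addnC _ ((2 * N).+1 * _)%N) !(mulnC (2 * N).+1) !divnMDl // !divn_small ?addn0.
by move: E; rewrite bb => /addIn ->.
Qed.

End LaurentSums.

(** * Polynomial relations in the sides and [J], and their specialization *)

Section Specialization.
Variable C : numFieldType.

Let o0 : 'I_3 := @Ordinal 3 0 isT.
Let o1 : 'I_3 := @Ordinal 3 1 isT.
Let o2 : 'I_3 := @Ordinal 3 2 isT.

Definition evq (p : {mpoly rat[3]}) (x : 'I_3 -> C) : C :=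
  (map_mpoly (ratr : rat -> C) p).@[x].

Lemma evqD p q x : evq (p + q) x = evq p x + evq q x.
Proof. by rewrite /evq rmorphD mevalD. Qed.
Lemma evqN p x : evq (- p) x = - evq p x.
Proof. by rewrite /evq rmorphN mevalN. Qed.
Lemma evqM p q x : evq (p * q) x = evq p x * evq q x.
Proof. by rewrite /evq rmorphM mevalM. Qed.
Lemma evq0 x : evq 0 x = 0.
Proof. by rewrite /evq rmorph0 meval0. Qed.
Lemma evq1 x : evq 1 x = 1.
Proof. by rewrite /evq rmorph1 meval1. Qed.
Lemma evqX i x : evq 'X_i x = x i.
Proof. by rewrite /evq map_mpolyX mevalXU. Qed.

(* Law of cosines: for the angle between the sides x0 and x1 of a triangle,
   cosine_side3 is 2 x0 x1 cos, and its square minus 4 x0^2 x1^2 is minus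
   sixteen times the squared area. *)
Definition cosine_side3 (x : 'I_3 -> C) := x o0 ^+ 2 + x o1 ^+ 2 - x o2 ^+ 2.
Definition cosine_side2 (x : 'I_3 -> C) := x o0 ^+ 2 + x o2 ^+ 2 - x o1 ^+ 2.
Definition heron (x : 'I_3 -> C) := cosine_side3 x ^+ 2 - 4 * x o0 ^+ 2 * x o1 ^+ 2.

(** Models the ring [Q[x0, x1, x2][J]] modulo [J^2 = heron]. As [U] and [V] are chosen before [x]
    and [J], the same polynomials serve at the generic triangle and at every specialization. *)
Definition quadratic_repr (F : ('I_3 -> C) -> C -> C) :=
  exists U V, forall x J, J ^+ 2 = heron x -> F x J = evq U x + J * evq V x.

Lemma repr_poly p : quadratic_repr (fun x _ => evq p x).
Proof. by exists p, 0 => x J _; rewrite evq0 mulr0 addr0. Qed.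

Lemma repr_ext F G : (forall x J, F x J = G x J) -> quadratic_repr F -> quadratic_repr G.
Proof. by move=> FG [U [V FE]]; exists U, V => x J xJ; rewrite -FG FE. Qed.

Lemma repr1 : quadratic_repr (fun _ _ => 1).
Proof. by apply: repr_ext (repr_poly 1) => x J; rewrite evq1. Qed.

Lemma reprX i : quadratic_repr (fun x _ => x i).
Proof. by apply: repr_ext (repr_poly 'X_i) => x J; rewrite evqX. Qed.

Lemma reprJ : quadratic_repr (fun _ J => J).
Proof. by exists 0, 1 => x J _; rewrite evq0 evq1 mulr1 add0r. Qed.

Lemma reprD F G : quadratic_repr F -> quadratic_repr G ->
  quadratic_repr (fun x J => F x J + G x J).
Proof.
move=> [U [V FE]] [U' [V' GE]]; exists (U + U'), (V + V') => x J xJ.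
by rewrite FE // GE // !evqD mulrDr addrACA.
Qed.

Lemma reprN F : quadratic_repr F -> quadratic_repr (fun x J => - F x J).
Proof.
move=> [U [V FE]]; exists (- U), (- V) => x J xJ.
by rewrite FE // !evqN mulrN -opprD.
Qed.

Lemma reprM F G : quadratic_repr F -> quadratic_repr G ->
  quadratic_repr (fun x J => F x J * G x J).
Proof.
move=> [U [V FE]] [U' [V' GE]].
(* [D] replaces [J^2] when the product is expanded. *)
have [D DE] : exists D, forall x, evq D x = heron x.
  pose P : {mpoly rat[3]} := 'X_o0 * 'X_o0 + 'X_o1 * 'X_o1 - 'X_o2 * 'X_o2.
  pose Q : {mpoly rat[3]} := 'X_o0 * 'X_o0 * ('X_o1 * 'X_o1).
  exists (P * P - (Q + Q + Q + Q)) => x.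
  rewrite /P /Q !(evqD, evqN, evqM, evqX) /heron /cosine_side3; ring.
exists (U * U' + D * (V * V')), (U * V' + U' * V) => x J xJ.
rewrite FE // GE // !(evqD, evqM) DE -xJ.
move: (evq U x) (evq V x) (evq U' x) (evq V' x) => u v u' v'; ring.
Qed.

Lemma reprXn F n : quadratic_repr F -> quadratic_repr (fun x J => F x J ^+ n).
Proof.
move=> rF; elim: n => [|n IH]; first exact: repr1.
by apply: repr_ext (reprM rF IH) => x J; rewrite exprS.
Qed.

Lemma repr_sum (I : Type) (r : seq I) (F : I -> ('I_3 -> C) -> C -> C) :
  (forall i, quadratic_repr (F i)) -> quadratic_repr (fun x J => \sum_(i <- r) F i x J).
Proof.
move=> rF; elim: r => [|i r IH].
  by apply: repr_ext (repr_poly 0) => x J; rewrite big_nil evq0.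
by apply: repr_ext (reprD (rF i) IH) => x J; rewrite big_cons.
Qed.

Lemma repr_nat n : quadratic_repr (fun _ _ => n%:R).
Proof.
apply: repr_ext (repr_poly n%:R) => x J.
by rewrite /evq !rmorph_nat.
Qed.

(** This is [nat_sum] at [z = (cosine_side3 + J)^2 / (4 x0^2 x1^2)] and
    [w = (cosine_side2 + J)^2 / (4 x0^2 x2^2)], multiplied by the power [2 N] of both denominators.
    The squares occur because the rotations turn through twice the angles of the triangle. *)
Definition cleared_sum N L (x : 'I_3 -> C) (J : C) : C :=
  \sum_(t <- L) sgnr C t.2 *
     ((cosine_side3 x + J) ^+ 2) ^+ `|t.1.1 + N%:Z| *
     (4 * x o0 ^+ 2 * x o1 ^+ 2) ^+ (2 * N - `|t.1.1 + N%:Z|) *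
     ((cosine_side2 x + J) ^+ 2) ^+ `|t.1.2 + N%:Z| *
     (4 * x o0 ^+ 2 * x o2 ^+ 2) ^+ (2 * N - `|t.1.2 + N%:Z|).

Lemma repr_cleared_sum N L : quadratic_repr (cleared_sum N L).
Proof.
have r3 : quadratic_repr (fun x J => cosine_side3 x + J).
  by do ![apply: reprD|apply: reprN|apply: reprXn|apply: reprX|apply: reprJ].
have r2 : quadratic_repr (fun x J => cosine_side2 x + J).
  by do ![apply: reprD|apply: reprN|apply: reprXn|apply: reprX|apply: reprJ].
have r4 i j : quadratic_repr (fun x _ => 4 * x i ^+ 2 * x j ^+ 2).
  by do ![apply: reprM|apply: repr_nat|apply: reprXn|apply: reprX].
apply: repr_sum => -[[n m] s] /=.
apply: reprM; last exact: reprXn.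
apply: reprM; last by do 2![apply: reprXn].
apply: reprM; last exact: reprXn.
apply: reprM; last by do 2![apply: reprXn].
case: s; first exact: repr1.
exact/reprN/repr1.
Qed.

Lemma cleared_sumE N L x J z w : bounded_by N L ->
  (cosine_side3 x + J) ^+ 2 = z * (4 * x o0 ^+ 2 * x o1 ^+ 2) ->
  (cosine_side2 x + J) ^+ 2 = w * (4 * x o0 ^+ 2 * x o2 ^+ 2) ->
  cleared_sum N L x J = nat_sum N L z w *
    ((4 * x o0 ^+ 2 * x o1 ^+ 2) ^+ (2 * N) * (4 * x o0 ^+ 2 * x o2 ^+ 2) ^+ (2 * N)).
Proof.
move=> bN zE wE; rewrite /cleared_sum /nat_sum zE wE mulr_suml.
apply: eq_big_seq => -[[n m] s] /bN /= [nN mN].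
have E (c : C) (k : int) : (`|k| <= N)%N ->
    c ^+ (2 * N) = c ^+ `|k + N%:Z| * c ^+ (2 * N - `|k + N%:Z|).
  by move=> kN; rewrite -exprD; congr (_ ^+ _); lia.
rewrite (E _ n nN) (E (4 * x o0 ^+ 2 * x o2 ^+ 2) m mN) !(exprMn_comm _ (mulrC _ _)).
ring.
Qed.

(* With S = exp(iC) and T = exp(iB), the sines of the angles A, B, C are, up to
   the factor 2i, these rational functions of S and T; by the law of sines they
   are the sides of a triangle, whose two rotation factors are S^2 and T^2. *)
Definition sine_sides (S T : C) (i : 'I_3) : C :=
  match val i with 0 => S * T - (S * T)^-1 | 1 => T - T^-1 | _ => S - S^-1 end.

(** The value of [J] is [2i x0 x1 sin C]; here [2i sin C] is the side [x2] itself, which gives the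
    product of the three sides. *)
Definition sine_area (S T : C) : C :=
  (S * T - (S * T)^-1) * (T - T^-1) * (S - S^-1).

Lemma sine_heron S T : S != 0 -> T != 0 ->
  sine_area S T ^+ 2 = heron (sine_sides S T).
Proof.
move=> S0 T0; rewrite /heron /cosine_side3 /sine_area /sine_sides /=.
by field; rewrite S0 T0.
Qed.

Lemma sine_side3 S T : S != 0 -> T != 0 ->
  (cosine_side3 (sine_sides S T) + sine_area S T) ^+ 2 =
  S ^+ 2 * (4 * sine_sides S T o0 ^+ 2 * sine_sides S T o1 ^+ 2).
Proof.
move=> S0 T0; rewrite /cosine_side3 /sine_area /sine_sides /=.
by field; rewrite S0 T0.
Qed.

Lemma sine_side2 S T : S != 0 -> T != 0 ->
  (cosine_side2 (sine_sides S T) + sine_area S T) ^+ 2 =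
  T ^+ 2 * (4 * sine_sides S T o0 ^+ 2 * sine_sides S T o2 ^+ 2).
Proof.
move=> S0 T0; rewrite /cosine_side2 /sine_area /sine_sides /=.
by field; rewrite S0 T0.
Qed.

Lemma sine_sides_neq0 (s t : nat) i : (1 < s)%N -> (1 < t)%N ->
  sine_sides s%:R t%:R i != 0.
Proof.
move=> s1 t1.
have nz (k : nat) : (1 < k)%N -> (k%:R : C) - k%:R^-1 != 0.
  move=> k1; have k0 : (k%:R : C) != 0 by rewrite pnatr_eq0; lia.
  rewrite -(inj_eq (mulIf k0)) mul0r mulrBl mulVf // -natrM subr_eq0.
  by rewrite (eqr_nat _ _ 1); lia.
rewrite /sine_sides; case: (val i) => [|[|_]]; rewrite -?natrM; apply: nz; lia.
Qed.

Lemma cleared_sum_coef N L : bounded_by N L ->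
  (forall x J, J ^+ 2 = heron x -> cleared_sum N L x J = 0) ->
  forall nm, coef L nm = 0.
Proof.
move=> bN vanish; apply: (@nat_sum_coef C N L bN) => s t s1 t1.
have [S0 T0] : (s%:R : C) != 0 /\ (t%:R : C) != 0 by rewrite !pnatr_eq0; lia.
have /eqP := vanish _ _ (sine_heron S0 T0).
rewrite (cleared_sumE bN (sine_side3 S0 T0) (sine_side2 S0 T0)).
rewrite mulf_eq0 => /orP[/eqP //|].
by rewrite !(mulf_eq0, expf_eq0, pnatr_eq0) !(negPf (sine_sides_neq0 _ s1 t1)) !andbF.
Qed.

End Specialization.

(** * From algebraically independent sides to arbitrary ones *)

Section GenericPoint.
Variable R : realType.
Local Notation C := R[i].
Local Open Scope complex_scope.

Lemma evq_real p (x : 'I_3 -> R) :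
  evq p (fun i => (x i)%:C) = ((map_mpoly (ratr : rat -> R) p).@[x])%:C.
Proof.
elim/mpolyind: p => [|c m p _ _ IH]; first by rewrite evq0 rmorph0 meval0.
rewrite evqD {}IH rmorphD mevalD /= rmorphD /=; congr (_ + _).
rewrite /evq !map_mpolyZ !map_mpolyX !mevalZ !mevalX rmorphM /= fmorph_rat.
congr (_ * _); rewrite rmorph_prod; apply: eq_bigr => i _.
by rewrite rmorphXn.
Qed.

Lemma repr_vanish F (x : 'I_3 -> R) (y : R) : quadratic_repr F -> alg_indep3 x ->
  y != 0 -> (0 +i* y) ^+ 2 = heron (fun i => (x i)%:C) ->
  F (fun i => (x i)%:C) (0 +i* y) = 0 ->
  forall x' J', J' ^+ 2 = heron x' -> F x' J' = 0.
Proof.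
move=> [U [V FE]] xi y0 hy; rewrite FE // !evq_real => /eqP.
(* The real part is the value of [U], the imaginary part [y] times the value of [V]. *)
rewrite eq_complex /=; simpc => /andP[/eqP U0 /eqP V0] x' J' hx'.
have polE (p : {mpoly rat[3]}) : (map_mpoly (ratr : rat -> R) p).@[x] = 0 -> p = 0.
  by move=> p0; apply/eqP/negPn/negP => /xi; rewrite p0 eqxx.
have -> : F x' J' = evq U x' + J' * evq V x' by apply: FE.
move/eqP: V0; rewrite mulf_eq0 (negPf y0) /= => /eqP /polE ->.
by rewrite (polE _ U0) !evq0 mulr0 addr0.
Qed.

Theorem laurent_sum_coef (x : 'I_3 -> R) (y : R) (z w : C) L :
  alg_indep3 x -> y != 0 ->
  (0 +i* y) ^+ 2 = heron (fun i => (x i)%:C) ->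
  (cosine_side3 (fun i => (x i)%:C) + (0 +i* y)) ^+ 2 =
    z * (4 * (x (@Ordinal 3 0 isT))%:C ^+ 2 * (x (@Ordinal 3 1 isT))%:C ^+ 2) ->
  (cosine_side2 (fun i => (x i)%:C) + (0 +i* y)) ^+ 2 =
    w * (4 * (x (@Ordinal 3 0 isT))%:C ^+ 2 * (x (@Ordinal 3 2 isT))%:C ^+ 2) ->
  z != 0 -> w != 0 ->
  laurent_sum L z w = 0 -> forall nm, coef L nm = 0.
Proof.
move=> xi y0 hy zE wE z0 w0 L0.
have [N bN] := bounded_by_ex L.
apply: (@cleared_sum_coef C N L bN).
apply: repr_vanish (repr_cleared_sum C N L) xi y0 hy _.
by rewrite (cleared_sumE bN zE wE) nat_sumE // L0 !mul0r.
Qed.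

End GenericPoint.

(** * The triangle group *)

(** The commutator of the rotations about [A] and [B] with factors [z] and [w], the one about [A]
    being applied first. *)
Lemma affine_commutator (K : fieldType) (z w A B x : K) : z != 0 -> w != 0 ->
  w^-1 * (z^-1 * (w * (z * x + (A - z * A)) + (B - w * B)) - z^-1 * (A - z * A))
    - w^-1 * (B - w * B) =
  1 * x + (1 - z) * (1 - w) * (B - A) / (z * w).
Proof. by move=> z0 w0; field; rewrite z0 w0. Qed.

(** Used with [q = k^2] and with [e], [e'] the conjugates of the edge vectors [d], [d']: then
    [q d e] and [q d' e'] are squared scaled sides, and [(d / e) (e' / d')] is the factor of the
    rotation. *)
Lemma rotation_factor (K : fieldType) (q d e d' e' : K) :
  e != 0 -> d' != 0 ->
  (2 * q * (d * e')) ^+ 2 = d / e * (e' / d') * (4 * (q * (d * e)) * (q * (d' * e'))).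
Proof. by move=> e0 d'0; field; rewrite e0 d'0. Qed.

Section Triangle.
Variables (R : realType) (A1 A2 A3 : point R).
Hypothesis ncol : noncollinear A1 A2 A3.
Local Notation C := R[i].
Local Open Scope complex_scope.

Let conjcM (a b : C) : conjc (a * b) = conjc a * conjc b.
Proof. exact: rmorphM. Qed.
Let conjcD (a b : C) : conjc (a + b) = conjc a + conjc b.
Proof. exact: rmorphD. Qed.
Let conjcB (a b : C) : conjc (a - b) = conjc a - conjc b.
Proof. exact: rmorphB. Qed.

(** * Words as affine maps of the complex plane *)

Definition toC (p : point R) : C := p.1 +i* p.2.

Lemma toC_inj : injective toC.
Proof. by case=> a b [c d] [-> ->]. Qed.

Lemma toC_surj (z : C) : exists p, toC p = z.
Proof. by case: z => a b; exists (a, b). Qed.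

(* The reflection in a line of direction d has linear part u |-> (d / d^* ) u^*. *)
Definition refl_factor (P Q : point R) : C :=
  (toC Q - toC P) / conjc (toC Q - toC P).

Lemma conj_dir_neq0 (P Q : point R) : P != Q -> conjc (toC Q - toC P) != 0.
Proof. by rewrite conjc_eq0 subr_eq0 eq_sym; apply: contraNneq => /toC_inj ->. Qed.

Lemma toC_reflect_line P Q x : P != Q ->
  toC (reflect_line P Q x) = toC P + refl_factor P Q * conjc (toC x - toC P).
Proof.
case: P Q x => [a b] [c d] [x y] PQ.
have n0 : (c - a) ^+ 2 + (d - b) ^+ 2 != 0.
  rewrite paddr_eq0 ?sqr_ge0 // !sqrf_eq0 !subr_eq0.
  by apply: contraNN PQ => /andP[/eqP-> /eqP->].
apply/eqP; rewrite eq_complex /=.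
apply/andP; split; apply/eqP; rewrite /pdot /=; field; rewrite -?expr2 ?sqrrN ?n0 //.
Qed.

Lemma refl_factorE P Q : P != Q ->
  refl_factor P Q * conjc (toC Q - toC P) = toC Q - toC P.
Proof. by move=> PQ; rewrite /refl_factor divfK // conj_dir_neq0. Qed.

(** Allows both reflections of a rotation to be expanded about their common vertex. *)
Lemma toC_reflect_lineC P Q x : P != Q ->
  toC (reflect_line P Q x) = toC Q + refl_factor P Q * conjc (toC x - toC Q).
Proof.
move=> PQ; rewrite toC_reflect_line //.
have -> : toC x - toC P = (toC x - toC Q) + (toC Q - toC P) by rewrite addrA subrK.
by rewrite conjcD mulrDr refl_factorE // addrCA [toC P + _]addrC subrK addrC.
Qed.

Lemma refl_factor_neq0 P Q : P != Q -> refl_factor P Q != 0.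
Proof.
move=> PQ; rewrite mulf_neq0 // ?invr_eq0 ?conj_dir_neq0 //.
by have := conj_dir_neq0 PQ; rewrite conjc_eq0.
Qed.

Lemma refl_factor_conj P Q : P != Q -> refl_factor P Q * conjc (refl_factor P Q) = 1.
Proof.
move=> PQ; have := conj_dir_neq0 PQ; rewrite /refl_factor.
move: (toC Q - toC P) => d d0; rewrite conjcM conjc_inv conjcK.
by rewrite mulrA divfK // mulfV // -conjc_eq0.
Qed.

Let addrKl (a b : C) : a + b - a = b.
Proof. by rewrite addrC addKr. Qed.

Lemma reflect_lineK (P Q : point R) : P != Q -> involutive (reflect_line P Q).
Proof.
move=> PQ x; apply: toC_inj; rewrite !toC_reflect_line // addrKl.
by rewrite conjcM conjcK mulrA refl_factor_conj // mul1r addrC subrK.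
Qed.

Lemma vertices_neq : [/\ A1 != A2, A1 != A3 & A2 != A3].
Proof.
split; apply/negP => /eqP E; move: ncol; rewrite /noncollinear E; apply/negP/negPn/eqP; ring.
Qed.

Lemma edge_neq i : (edge_pts A1 A2 A3 i).1 != (edge_pts A1 A2 A3 i).2.
Proof. by have [? ? ?] := vertices_neq; rewrite /edge_pts; case: (val i) => [|[]]. Qed.

Local Notation ev := (eval_word A1 A2 A3).

Lemma reflK i : involutive (refl A1 A2 A3 i).
Proof. exact/reflect_lineK/edge_neq. Qed.

Lemma eval_cat u v x : ev (u ++ v) x = ev v (ev u x).
Proof. by elim: u x => //= l u IH x; rewrite IH. Qed.

Lemma eval_invK w : cancel (ev w) (ev (inv_word w)).
Proof.
elim: w => //= l w IH x.
by rewrite -cat1s inv_word_cat eval_cat IH /= reflK.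
Qed.

Lemma eval_Vinv w : cancel (ev (inv_word w)) (ev w).
Proof. by move=> x; rewrite -{1}(inv_wordK w) eval_invK. Qed.

Definition affine (w : word) (r t : C) := forall x, toC (ev w x) = r * toC x + t.

Lemma affine_cat u v r t r' t' : affine u r t -> affine v r' t' ->
  affine (u ++ v) (r' * r) (r' * t + t').
Proof. by move=> au av x; rewrite eval_cat av au mulrDr mulrA addrA. Qed.

Lemma affine_inv w r t : r != 0 -> affine w r t -> affine (inv_word w) r^-1 (- (r^-1 * t)).
Proof.
move=> r0 aw x; rewrite -[in RHS](eval_Vinv w x) aw mulrDr mulKf //.
by rewrite addrK.
Qed.

Lemma affine_nil : affine [::] 1 0.
Proof. by move=> x; rewrite mul1r addr0. Qed.

Lemma affine_pow w r t n : r != 0 -> affine w r t -> exists t', affine (pow_word w n) (r ^ n) t'.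
Proof.
move=> r0 aw.
have nat_pow u q s k : affine u q s -> exists t', affine (flatten (nseq k u)) (q ^+ k) t'.
  move=> au; elim: k => [|k [t' IH]]; first by exists 0; apply: affine_nil.
  by eexists; rewrite /= exprSr; apply: affine_cat au IH.
case: n => k; first exact: nat_pow aw.
have -> : r ^ Negz k = r^-1 ^+ k.+1 by rewrite exprVn.
exact: nat_pow (affine_inv r0 aw).
Qed.

Lemma affine_conj h v r s t : r != 0 -> affine h r s -> affine v 1 t ->
  affine (inv_word h ++ v ++ h) 1 (r * t).
Proof.
move=> r0 ah av x; rewrite !eval_cat ah av mul1r mulrDr addrAC -ah eval_Vinv.
by rewrite mul1r.
Qed.

Lemma affine_id w r t : affine w r t -> (forall x, ev w x = x) -> r = 1 /\ t = 0.
Proof.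
move=> aw wid.
have E z : z = r * z + t by have [p <-] := toC_surj z; rewrite -aw wid.
have t0 : t = 0 by have := E 0; rewrite mulr0 add0r.
by split=> //; have := E 1; rewrite t0 mulr1 addr0.
Qed.

Lemma eval_comm_translations u v s t : affine u 1 s -> affine v 1 t ->
  forall x, ev (comm_word u v) x = x.
Proof.
move=> au av x; rewrite /comm_word !eval_cat.
have -> : ev v (ev u x) = ev u (ev v x).
  by apply: toC_inj; rewrite av au au av !mul1r addrAC.
by rewrite !eval_invK.
Qed.

Lemma eval_parity w : exists r t,
  forall x, toC (ev w x) = r * (if odd (size w) then conjc (toC x) else toC x) + t.
Proof.
elim: w => [|l w [r [t IH]]]; first by exists 1, 0 => x; rewrite mul1r addr0.
have [u [s rE]] : exists u s, forall x, toC (refl A1 A2 A3 l.1 x) = u * conjc (toC x) + s.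
  set P := (edge_pts A1 A2 A3 l.1).1; set u := refl_factor P (edge_pts A1 A2 A3 l.1).2.
  exists u, (toC P - u * conjc (toC P)) => x.
  by rewrite toC_reflect_line ?edge_neq // conjcB mulrBr addrCA.
have {}rE x : toC (ev (l :: w) x) = toC (ev w (refl A1 A2 A3 l.1 x)) /\
  toC (refl A1 A2 A3 l.1 x) = u * conjc (toC x) + s by [].
have -> : odd (size (l :: w)) = ~~ odd (size w) by [].
case: (odd (size w)) IH => IH.
  exists (r * conjc u), (r * conjc s + t) => x; have [-> E] := rE x.
  by rewrite IH E conjcD conjcM conjcK mulrDr mulrA addrA.
exists (r * u), (r * s + t) => x; have [-> E] := rE x.
by rewrite IH E mulrDr mulrA addrA.
Qed.

(** A word of odd length acts as [r * conjc z + t]. Fixing [0] and [1] forces [t = 0] and [r = 1],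
    and then [i] is sent to [-i]. *)
Lemma eval_id_even w : (forall x, ev w x = x) -> ~~ odd (size w).
Proof.
move=> wid; have [r [t E]] := eval_parity w; apply/negP => o; rewrite o in E.
have {}E z : z = r * conjc z + t by have [p <-] := toC_surj z; rewrite -E wid.
have t0 : t = 0 by have := E 0; rewrite conjc0 mulr0 add0r.
have r1 : r = 1 by have := E 1; rewrite conjc1 t0 mulr1 addr0.
have := E (0 +i* 1); rewrite r1 t0 mul1r addr0 => /eqP.
by rewrite eq_complex /= eqxx /= -subr_eq0 opprK -(natrD _ 1 1) pnatr_eq0.
Qed.

(** Words act from left to right, so the factor of the reflection applied first is conjugated by the
    second one. *)
Definition rot_factor_a : C := refl_factor A2 A3 * conjc (refl_factor A1 A3).
Definition rot_factor_b : C := refl_factor A1 A2 * conjc (refl_factor A2 A3).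
Local Notation z := rot_factor_a.
Local Notation w := rot_factor_b.

Lemma rot_factor_a_neq0 : z != 0.
Proof.
by have [? ? ?] := vertices_neq; rewrite mulf_neq0 ?conjc_eq0 ?refl_factor_neq0.
Qed.

Lemma rot_factor_b_neq0 : w != 0.
Proof.
by have [? ? ?] := vertices_neq; rewrite mulf_neq0 ?conjc_eq0 ?refl_factor_neq0.
Qed.

Lemma affine_a : affine (x2 ++ x1) z (toC A3 - z * toC A3).
Proof.
have [n12 n13 n23] := vertices_neq => x.
rewrite /= /refl /edge_pts /= !toC_reflect_lineC // addrKl.
rewrite conjcM conjcK mulrA mulrBr addrC -addrA; congr (_ + _).
exact: addrC.
Qed.

Lemma affine_b : affine (x1 ++ x3) w (toC A2 - w * toC A2).
Proof.
have [n12 n13 n23] := vertices_neq => x.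
rewrite /= /refl /edge_pts /= toC_reflect_lineC // toC_reflect_line //.
rewrite addrKl.
rewrite conjcM conjcK mulrA mulrBr addrC -addrA; congr (_ + _).
exact: addrC.
Qed.

Definition trans_v : C := (1 - z) * (1 - w) * (toC A2 - toC A3) / (z * w).

Lemma affine_v : affine v_word 1 trans_v.
Proof.
move=> x; rewrite /v_word /comm_word !eval_cat.
rewrite (affine_inv rot_factor_b_neq0 affine_b) (affine_inv rot_factor_a_neq0 affine_a).
rewrite affine_b affine_a.
exact: affine_commutator rot_factor_a_neq0 rot_factor_b_neq0.
Qed.

Lemma affine_h n m : exists t, affine (h_word n m) (z ^ n * w ^ m) t.
Proof.
have [s Hs] := affine_pow n rot_factor_a_neq0 affine_a.
have [t Ht] := affine_pow m rot_factor_b_neq0 affine_b.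
by eexists; rewrite mulrC; apply: affine_cat Hs Ht.
Qed.

Lemma affine_vconj n m :
  affine (inv_word (h_word n m) ++ v_word ++ h_word n m) 1 (z ^ n * w ^ m * trans_v).
Proof.
have [t ht] := affine_h n m; apply: affine_conj ht affine_v.
by rewrite mulf_neq0 // expfz_neq0 // ?rot_factor_a_neq0 ?rot_factor_b_neq0.
Qed.

Lemma affine_commconj_word L : affine (commconj_word L) 1 (laurent_sum L z w * trans_v).
Proof.
elim: L => [|[[n m] s] L IH].
  by rewrite /laurent_sum big_nil mul0r; apply: affine_nil.
rewrite /laurent_sum big_cons mulrDl /= => x.
rewrite [commconj_word _]/= eval_cat IH mul1r /=.
have hv := affine_vconj n m.
case: s; rewrite /sgnr ?mul1r.
  by rewrite hv mul1r addrA.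
rewrite (affine_inv (oner_neq0 _) hv) invr1 !mul1r addrA !mulN1r !mulNr.
by [].
Qed.

(** Soundness of the relators: reflections are involutions, and [v] and its conjugates act as
    translations, which commute. *)
Lemma wequiv_eval u v : wequiv u v -> ev u =1 ev v.
Proof.
elim=> {u v} [//|u v _ IH x|u v t _ IH1 _ IH2 x|u r v rr x|u l v x].
- by rewrite IH.
- by rewrite IH1.
- rewrite !eval_cat; congr (ev v _).
  case: rr => [[i ->]|[n [m [_ ->]]]]; first by rewrite /= reflK.
  exact: eval_comm_translations affine_v (affine_vconj n m) _.
- by rewrite !eval_cat /= reflK.
Qed.

(** * Completeness of the relators for a generic triangle *)

Section Generic.
Variable k : R.
Hypothesis k_gt0 : 0 < k.
Let x (i : 'I_3) : R := k * edge_len A1 A2 A3 i.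
Hypothesis xi : alg_indep3 x.

Lemma laurent_indep L : laurent_sum L z w = 0 -> forall nm, coef L nm = 0.
Proof.
have [n12 n13 n23] := vertices_neq.
have xE i : (x i)%:C ^+ 2 = (k ^+ 2)%:C *
    ((toC (edge_pts A1 A2 A3 i).2 - toC (edge_pts A1 A2 A3 i).1) *
     conjc (toC (edge_pts A1 A2 A3 i).2 - toC (edge_pts A1 A2 A3 i).1)).
  rewrite -rmorphXn /= /x exprMn /edge_len /dist sqr_sqrtr; last first.
    by rewrite /pdot -!expr2 addr_ge0 // sqr_ge0.
  case: (edge_pts _ _ _ _) => [[a b] [c d]] /=.
  apply/eqP; rewrite eq_complex /=; apply/andP; split; apply/eqP; rewrite /pdot /=; ring.
(* Four times the signed area of the scaled triangle, with the sign for which [cosine_side3 + i y]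
   is [2 k^2] times the product of one edge vector and the conjugate of the other. *)
pose y : R := 2 * k ^+ 2 *
  ((A3.2 - A2.2) * (A3.1 - A1.1) - (A3.1 - A2.1) * (A3.2 - A1.2)).
have y0 : y != 0.
  apply: mulf_neq0; first by rewrite mulf_neq0 ?pnatr_eq0 // expf_neq0 // gt_eqF.
  rewrite (_ : _ - _ = (A2.1 - A1.1) * (A3.2 - A1.2) - (A2.2 - A1.2) * (A3.1 - A1.1)) //.
  ring.
have c3 : cosine_side3 (fun i => (x i)%:C) + (0 +i* y) = 2 * (k ^+ 2)%:C *
    ((toC A3 - toC A2) * conjc (toC A3 - toC A1)).
  rewrite /cosine_side3 !xE /edge_pts /=.
  apply/eqP; rewrite eq_complex /=; apply/andP; split; apply/eqP; rewrite /y /=; ring.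
have c2 : cosine_side2 (fun i => (x i)%:C) + (0 +i* y) = - (2 * (k ^+ 2)%:C *
    ((toC A2 - toC A1) * conjc (toC A3 - toC A2))).
  rewrite /cosine_side2 !xE /edge_pts /=.
  apply/eqP; rewrite eq_complex /=; apply/andP; split; apply/eqP; rewrite /y /=; ring.
have rot_factorE P Q P' Q' : refl_factor P Q * conjc (refl_factor P' Q') =
    (toC Q - toC P) / conjc (toC Q - toC P) * (conjc (toC Q' - toC P') / (toC Q' - toC P')).
  by rewrite /refl_factor [conjc (_ / _)]conjcM conjc_inv conjcK.
apply: (laurent_sum_coef xi y0).
- rewrite /heron /cosine_side3 !xE /edge_pts /=.
  apply/eqP; rewrite eq_complex /=; apply/andP; split; apply/eqP; rewrite /y /=; ring.
- rewrite c3 !xE /rot_factor_a rot_factorE.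
  by apply: rotation_factor; rewrite ?conj_dir_neq0 // -conjc_eq0 conj_dir_neq0.
- rewrite c2 sqrrN !xE /rot_factor_b rot_factorE [X in _ = _ * X]mulrAC.
  by apply: rotation_factor; rewrite ?conj_dir_neq0 // -conjc_eq0 conj_dir_neq0.
- exact: rot_factor_a_neq0.
- exact: rot_factor_b_neq0.
Qed.

Lemma monomial_eq1 n m : z ^ n * w ^ m = 1 -> n = 0 /\ m = 0.
Proof.
move=> E.
(* The list encodes [z^n w^m - 1], whose coefficient at [(0, 0)] is [-1] unless [n = m = 0]. *)
have := @laurent_indep [:: (n, m, true); (0, 0, false)].
rewrite /laurent_sum !big_cons big_nil /sgnr /= mul1r E !expr0z !mulr1 addr0 subrr.
move=> /(_ erefl (0, 0)); rewrite /coef !big_cons big_nil /=.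
by case: eqP => [[-> ->]|].
Qed.

Lemma trans_v_neq0 : trans_v != 0.
Proof.
have [n12 n13 n23] := vertices_neq.
have neq1 n m : (n, m) != (0, 0) -> 1 - z ^ n * w ^ m != 0.
  by move=> nm; rewrite subr_eq0 eq_sym; apply: contraNneq nm => /monomial_eq1[-> ->].
have z1 : 1 - z != 0 by have := neq1 1 0 isT; rewrite expr1z expr0z mulr1.
have w1 : 1 - w != 0 by have := neq1 0 1 isT; rewrite expr1z expr0z mul1r.
apply: mulf_neq0; last first.
  by rewrite invr_eq0 mulf_neq0 ?rot_factor_a_neq0 ?rot_factor_b_neq0.
apply: mulf_neq0; first exact: mulf_neq0.
by rewrite -conjc_eq0 conj_dir_neq0 // eq_sym.
Qed.

(** In the normal form, the linear part [z^n w^m = 1] gives [n = m = 0]. What remains is a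
    translation by [laurent_sum] times [trans_v], so [laurent_sum] vanishes and all coefficients are
    zero. *)
Lemma eval_id_wequiv u : (forall p, ev u p = p) -> wequiv u [::].
Proof.
move=> uid; have [n [m [L uE]]] := even_normal_form (eval_id_even uid).
have hid p : ev (h_word n m ++ commconj_word L) p = p by rewrite -(wequiv_eval uE).
have [t ht] := affine_h n m.
have [] := affine_id (affine_cat ht (@affine_commconj_word L)) hid.
rewrite mul1r => /monomial_eq1[n0 m0]; rewrite {}n0 {}m0 in uE hid.
(* [h_word 0 0] computes to the empty word, so [hid] now speaks of [commconj_word L] alone. *)
have [_ /eqP] := affine_id (@affine_commconj_word L) hid.
rewrite mulf_eq0 (negPf trans_v_neq0) orbF => /eqP L0 _.
exact: wequiv_trans uE (commconj_word_nil (laurent_indep L0)).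
Qed.

End Generic.
End Triangle.

(* G_tau has presentation < x1,x2,x3 | relators > via x_i |-> r_i:
   two words represent the same element of G_tau iff they are equivalent
   modulo the relators (and every element of G_tau is, by definition of
   G_tau = <r1,r2,r3>, the value of a word: see in_G). *)
Theorem theorem5p3 (R : realType) (A1 A2 A3 : point R) :
  noncollinear A1 A2 A3 ->
  generic_triangle A1 A2 A3 ->
  forall w1 w2 : word,
    eval_word A1 A2 A3 w1 = eval_word A1 A2 A3 w2 <-> wequiv w1 w2.
Proof.
move=> ncol [k [k_gt0 xi]] w1 w2; split=> [E|/(wequiv_eval ncol) E]; last exact/funext.
have /(eval_id_wequiv ncol k_gt0 xi) : forall p, eval_word A1 A2 A3 (w1 ++ inv_word w2) p = p.
  by move=> p; rewrite eval_cat E eval_invK.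
move=> /clsP/eqP; rewrite cls_cat cls_inv cls_nil divg_eq1 => /eqP.
by move/clsP.
Qed.
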